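(* Let $G$ be a finite connected simple graph on $N\geq2$ vertices with chromatic number $\chi$ and largest normalized Laplacian eigenvalue $\lambda_N$. Fix a proper $\chi$-coloring with coloring classes $V_1,\dots,V_\chi$ whose sizes $N_i=|V_i|$ satisfy $N_1\geq N_2\geq\dots\geq N_\chi$, and let \[x=\min_{1\leq i\leq\chi,\ v\in V_i}\frac{\deg v}{N-N_i}.\] Then $\lambda_N\leq\frac1x\cdot\frac{N}{N-N_1}$. Furthermore, this inequality is sharp (equality is attained by some graph).
   Context: The normalized Laplacian is $L=\mathrm{Id}-D^{-1}A$, with $A$ the adjacency matrix and $D$ the diagonal degree matrix. *)

(* Defs.v *)
From mathcomp Require Import all_boot all_order all_algebra.

Set Implicit Arguments.
Unset Strict Implicit.
Unset Printing Implicit Defensive.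

Import Order.TTheory GRing.Theory Num.Theory.
Local Open Scope ring_scope.

Record sgraph := SGraph {
  vertex :> finType;
  edge : rel vertex;
  edge_sym : symmetric edge;
  edge_irrefl : irreflexive edge }.

Section Graph.
Variable G : sgraph.

Definition connected : Prop := forall u v : G, connect (@edge G) u v.

Definition deg (v : G) : nat := #|[set w | edge v w]|.

Definition proper_coloring (k : nat) (c : {ffun G -> 'I_k}) : bool :=
  [forall u, forall v, edge u v ==> (c u != c v)].

Definition colorable (k : nat) : bool :=
  [exists c : {ffun G -> 'I_k}, proper_coloring c].

Lemma ex_colorable : exists k, colorable k.
Proof.
exists #|G|; apply/existsP; exists [ffun v => enum_rank v].
apply/'forall_forallP => u v; apply/implyP => uv; rewrite !ffunE.
by apply: contraTneq uv => /enum_rank_inj ->; rewrite edge_irrefl.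
Qed.

Definition chromatic_number : nat := ex_minn ex_colorable.

(* Colors are numbered from 0, so the first class V_1 is color_class c 0. The *)
(* index is a nat, so that 0 can be named for any k; the class is empty for   *)
(* i >= k.                                                                    *)
Definition color_class (k : nat) (c : {ffun G -> 'I_k}) (i : nat) : {set G} :=
  [set v | nat_of_ord (c v) == i].

Definition decreasing_classes (k : nat) (c : {ffun G -> 'I_k}) : Prop :=
  forall i j : nat, (i <= j < k)%N ->
    (#|color_class c j| <= #|color_class c i|)%N.

(* Vertices are numbered by the canonical enumeration of the vertex type. *)
Definition adjacency_mx (R : pzRingType) : 'M[R]_#|G| :=
  \matrix_(i, j) (edge (enum_val i : G) (enum_val j))%:R.

Definition degree_mx (R : pzRingType) : 'M[R]_#|G| :=
  diag_mx (\row_i (deg (enum_val i))%:R).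

(* The degree matrix is invertible as soon as no vertex is isolated. *)
Definition normalized_laplacian (R : comUnitRingType) : 'M[R]_#|G| :=
  1%:M - invmx (degree_mx R) *m adjacency_mx R.

End Graph.

Definition is_minimum (R : numDomainType) (P : R -> Prop) (x : R) : Prop :=
  P x /\ forall y, P y -> x <= y.

Definition is_maximum (R : numDomainType) (P : R -> Prop) (x : R) : Prop :=
  P x /\ forall y, P y -> y <= x.

(* The library's eigenvalue uses row vectors (v *m A = a *: v), which gives   *)
(* the same eigenvalues as column vectors. The normalized Laplacian of a      *)
(* graph without isolated vertices is similar to a symmetric matrix, so over  *)
(* a real closed field all its eigenvalues lie in R.                          *)
Definition is_largest_eigenvalue (R : rcfType) (n : nat) (A : 'M[R]_n)
    (lambda : R) : Prop :=
  is_maximum (fun a => eigenvalue A a) lambda.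

Definition degree_ratio (R : rcfType) (G : sgraph) (k : nat)
    (c : {ffun G -> 'I_k}) (r : R) : Prop :=
  exists (i : 'I_k) (v : G), v \in color_class c i /\
    r = (deg v)%:R / (#|G|%:R - #|color_class c i|%:R).

Definition is_min_degree_ratio (R : rcfType) (G : sgraph) (k : nat)
    (c : {ffun G -> 'I_k}) (x : R) : Prop :=
  is_minimum (degree_ratio c) x.

(* Main.v *)
Require Import Defs.
From mathcomp Require Import all_boot all_order all_algebra.
From mathcomp Require Import ring lra.

(**
  An eigenvector [v] of the Laplacian for [a] corresponds to a function
  [f = v D^-1] with [D f - A f = a D f], so [a * sum deg(u) f(u)^2] is the sum
  of [(f u - f v)^2] over the edges.  Extending that sum to all pairs of
  vertices bounds it by [N * sum f(u)^2], whereas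
  [deg u >= x * (N - N_i) >= x * (N - N_1)] for [u] in [V_i].  The single edge
  [K2], with [x = 1] and largest eigenvalue [2], attains the bound.
*)

Set Implicit Arguments.
Unset Strict Implicit.

Import Order.TTheory GRing.Theory Num.Theory.
Local Open Scope ring_scope.

Lemma degree_mx_unit (R : numFieldType) (G : sgraph) :
  (forall v : G, (0 < deg v)%N) -> degree_mx G R \in unitmx.
Proof.
move=> deg_gt0; rewrite unitmxE det_diag unitfE; apply/prodf_neq0 => i _.
by rewrite mxE pnatr_eq0 -lt0n.
Qed.

(** Write a row eigenvector as [f D]. Then [f D (1 - D^-1 A) = f D - f A], which removes the
    inverse, and the symmetry of [edge] turns [f A] into a sum over neighbors. *)
Lemma eigenvalue_normalized_laplacian (R : numFieldType) (G : sgraph) (a : R) :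
    (forall v : G, (0 < deg v)%N) ->
  eigenvalue (normalized_laplacian G R) a <->
  exists f : G -> R, (exists u, f u != 0) /\
    forall u, (deg u)%:R * f u - \sum_v (edge u v)%:R * f v = a * ((deg u)%:R * f u).
Proof.
move=> /(degree_mx_unit R) Du.
pose w f : 'rV[R]_#|G| := \row_i f (enum_val i).
have wE (f : G -> R) i : (w f *m degree_mx G R *m normalized_laplacian G R) 0 i =
    let u := enum_val i in (deg u)%:R * f u - \sum_v (edge u v)%:R * f v.
  rewrite mulmxBr mulmx1 mulmxA mulmxK // mul_mx_diag !mxE /= mulrC.
  congr (_ - _); rewrite (big_enum_val (A := G)) /=.
  by apply: eq_bigr => j _; rewrite !mxE mulrC edge_sym.
have wDE (f : G -> R) i : (w f *m degree_mx G R) 0 i =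
    (deg (enum_val i : G))%:R * f (enum_val i).
  by rewrite mul_mx_diag !mxE mulrC.
split.
  case/eigenvalueP => v vL v0.
  (* Dividing [v] by the degrees recovers [f]. *)
  pose f u := (v *m invmx (degree_mx G R)) 0 (enum_rank u).
  have fE : w f *m degree_mx G R = v.
    rewrite -[RHS](mulmxKV Du); congr (_ *m _).
    by apply/rowP => i; rewrite mxE /f enum_valK.
  exists f; split; last first.
    by move=> u; have := wE f (enum_rank u); rewrite fE vL mxE -fE wDE enum_rankK.
  have [i vi] : exists i, v 0 i != 0 by apply/rV0Pn.
  by exists (enum_val i); move: vi; rewrite -fE wDE mulf_eq0 negb_or => /andP[].
case=> f [[u fu] fL]; apply/eigenvalueP; exists (w f *m degree_mx G R).
  by apply/rowP => i; rewrite wE /= fL [RHS]mxE wDE.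
apply: contra_neq fu => wf0.
have /rowP/(_ (enum_rank u)) : w f = 0 by rewrite -[LHS](mulmxK Du) wf0 mul0mx.
by rewrite !mxE enum_rankK.
Qed.

(** A discrete Green formula, to be applied both to the edge weights and to the constant weight
    1. *)
Lemma sum_sqr_sub (R : comPzRingType) (T : finType) (k : T -> T -> R) (f : T -> R) :
    (forall u v, k u v = k v u) ->
  \sum_u \sum_v k u v * (f u - f v) ^+ 2 =
    2 * \sum_u f u * \sum_v k u v * (f u - f v).
Proof.
move=> k_sym.
(* Split one factor of the square. With the weight written [k v u], the second sum is the first one
   with [u] and [v] exchanged. *)
have -> : \sum_u \sum_v k u v * (f u - f v) ^+ 2 =
    \sum_u \sum_v f u * (k u v * (f u - f v)) +
    \sum_u \sum_v f v * (k v u * (f v - f u)).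
  rewrite -big_split; apply: eq_bigr => u _; rewrite -big_split.
  by apply: eq_bigr => v _ /=; rewrite (k_sym v u); ring.
rewrite [X in _ + X]exchange_big -mulr2n mulr_natl.
by congr (_ *+ 2); apply: eq_bigr => u _; rewrite mulr_sumr.
Qed.

Lemma sum_edge (R : pzSemiRingType) (G : sgraph) (u : G) :
  \sum_v (edge u v)%:R = (deg u)%:R :> R.
Proof.
rewrite -natr_sum /deg -sum1dep_card [in RHS]big_mkcond.
by congr _%:R; apply: eq_bigr => v _; case: edge.
Qed.

(** By the Green formula, the two sides come from the Dirichlet forms of [G] and of the complete
    graph; the latter equals [N * sum f^2 - (sum f)^2], whose last term is dropped. *)
Lemma eigenvalue_sum_le (R : realFieldType) (G : sgraph) (f : G -> R) (a : R) :
    (forall u, (deg u)%:R * f u - \sum_v (edge u v)%:R * f v = a * ((deg u)%:R * f u)) ->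
  a * \sum_u (deg u)%:R * f u ^+ 2 <= #|G|%:R * \sum_u f u ^+ 2.
Proof.
move=> fL.
have le_pairs : \sum_u \sum_v (edge u v)%:R * (f u - f v) ^+ 2 <=
    \sum_u \sum_v 1 * (f u - f v) ^+ 2.
  apply: ler_sum => u _; apply: ler_sum => v _.
  by rewrite ler_wpM2r ?sqr_ge0 // lern1 leq_b1.
have sum_edges : \sum_u f u * \sum_v (edge u v)%:R * (f u - f v) =
    a * \sum_u (deg u)%:R * f u ^+ 2.
  rewrite mulr_sumr; apply: eq_bigr => u _.
  under eq_bigr do rewrite mulrBr.
  by rewrite big_split /= -mulr_suml sumrN sum_edge fL; ring.
have sum_pairs : \sum_u f u * \sum_v 1 * (f u - f v) =
    #|G|%:R * (\sum_u f u ^+ 2) - (\sum_u f u) ^+ 2.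
  rewrite expr2 mulr_sumr mulr_suml -sumrB; apply: eq_bigr => u _.
  under eq_bigr do rewrite mul1r.
  by rewrite big_split /= sumrN sumr_const -mulr_natl; ring.
rewrite !sum_sqr_sub ?sum_edges ?sum_pairs // in le_pairs; last first.
  by move=> u v; rewrite edge_sym.
have := sqr_ge0 (\sum_u f u); lra.
Qed.

Lemma connected_deg_gt0 (G : sgraph) (v : G) :
  (2 <= #|G|)%N -> connected G -> (0 < deg v)%N.
Proof.
move=> G2 Gconn.
have /card_gt0P[u] : (0 < #|predC1 v|)%N by rewrite cardC1 -subn1 subn_gt0.
rewrite inE => uv; have /connectP[p] := Gconn v u.
case: p => [_ /eqP|w p /= /andP[vw _] _]; first by rewrite /= (negPf uv).
by apply/card_gt0P; exists w; rewrite inE.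
Qed.

(** This makes the denominators [N - N_i] positive: a class containing every vertex would contain
    both ends of an edge. *)
Lemma class_lt_card (G : sgraph) (k : nat) (c : {ffun G -> 'I_k}) (i : nat) :
    (2 <= #|G|)%N -> connected G -> proper_coloring c ->
  (#|color_class c i| < #|G|)%N.
Proof.
move=> G2 Gconn cP; rewrite -cardsT; apply: proper_card.
rewrite properT; apply: contraTneq cP => cT.
have /card_gt0P[v _] : (0 < #|G|)%N by apply: leq_trans G2.
have /card_gt0P[w] := connected_deg_gt0 v G2 Gconn; rewrite inE => vw.
have ciE u : c u = i :> nat by have := in_setT u; rewrite -cT inE => /eqP.
apply/forallPn; exists v; apply/forallPn; exists w.
by rewrite vw /= negbK; apply/eqP/val_inj; rewrite /= !ciE.
Qed.

(** Treating an arbitrary eigenvalue lets the bound serve twice: for the inequality, and to show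
    that 2 is the largest eigenvalue of [K2]. *)
Lemma normalized_laplacian_eigenvalue_le (R : rcfType) (G : sgraph) (k : nat)
    (c : {ffun G -> 'I_k}) (x a : R) :
    (2 <= #|G|)%N -> connected G -> proper_coloring c -> decreasing_classes c ->
    is_min_degree_ratio c x -> eigenvalue (normalized_laplacian G R) a ->
  a <= 1 / x * (#|G|%:R / (#|G|%:R - #|color_class c 0|%:R)).
Proof.
move=> G2 Gconn cP c_decr [[i0 [v0 [_ x_def]]] x_min].
have deg_gt0 v := connected_deg_gt0 v G2 Gconn.
case/(eigenvalue_normalized_laplacian _ deg_gt0) => f [[u fu] fL].
pose n i : R := #|G|%:R - #|color_class c i|%:R.
have n_gt0 i : 0 < n i by rewrite subr_gt0 ltr_nat class_lt_card.
have x_gt0 : 0 < x by rewrite x_def divr_gt0 ?ltr0n ?deg_gt0 ?n_gt0.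
have le_deg (v : G) : x * n 0%N <= (deg v)%:R.
  have : x <= (deg v)%:R / n (c v) by apply: x_min; exists (c v), v; rewrite inE.
  rewrite ler_pdivlMr //; apply: le_trans.
  (* Class 0 is the largest, so [n 0] is the smallest of the [n i]. *)
  by rewrite ler_pM2l // lerD2l lerN2 ler_nat c_decr // leq0n ltn_ord.
have f2_gt0 : 0 < \sum_v f v ^+ 2.
  rewrite (bigD1 u) //= ltr_pwDl ?exprn_even_gt0 //.
  by rewrite sumr_ge0 // => v _; rewrite sqr_ge0.
have xn_gt0 : 0 < x * n 0%N by rewrite mulr_gt0.
have -> : 1 / x * (#|G|%:R / n 0%N) = #|G|%:R / (x * n 0%N).
  by rewrite mul1r invfM mulrCA.
(* Multiplying [le_deg] by [a] preserves the inequality only for [a > 0]; otherwise the left side is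
   at most 0, hence at most [N]. *)
rewrite ler_pdivlMr //; have [a_le0|a_gt0] := leP a 0.
  by rewrite (@le_trans _ _ 0) ?ler0n // mulr_le0_ge0 // ltW.
rewrite -(ler_pM2r f2_gt0) (le_trans _ (eigenvalue_sum_le fL)) //.
rewrite -mulrA ler_pM2l // mulr_sumr.
by apply: ler_sum => v _; rewrite ler_wpM2r ?sqr_ge0.
Qed.

Lemma neq_op_sym (T : eqType) : symmetric (fun u v : T => u != v).
Proof. by move=> u v; rewrite eq_sym. Qed.

Lemma neq_op_irrefl (T : eqType) : irreflexive (fun u v : T => u != v).
Proof. by move=> u; rewrite eqxx. Qed.

Definition complete_graph (T : finType) : sgraph :=
  SGraph (@neq_op_sym T) (@neq_op_irrefl T).

Definition K2 : sgraph := complete_graph bool.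

Definition K2_coloring : {ffun K2 -> 'I_2} := [ffun b : bool => inord b].

Lemma val_K2_coloring (b : bool) : K2_coloring b = b :> nat.
Proof. by rewrite ffunE inordK // ltnS leq_b1. Qed.

Lemma proper_K2_coloring : proper_coloring K2_coloring.
Proof.
apply/'forall_forallP => u v; apply/implyP; apply: contraNneq.
by move=> /(congr1 (@nat_of_ord 2)); rewrite !val_K2_coloring; case: u v => [] [].
Qed.

Lemma chromatic_number_K2 : chromatic_number K2 = 2.
Proof.
rewrite /chromatic_number; case: ex_minnP => k /existsP[c cP] k_min.
apply/anti_leq/andP; split.
  by apply: k_min; apply/existsP; exists K2_coloring; exact: proper_K2_coloring.
have /'forall_forallP/(_ true false) := cP.
(* Zero colors leave no value for [c true]; one color gives both ends of the edge the same value. *)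
by case: k c {cP k_min} => [|[|//]] c; [case: (c true) | rewrite !ord1].
Qed.

Lemma deg_K2 (v : K2) : deg v = 1%N.
Proof.
rewrite /deg -(cards1 (~~ v)); congr #|pred_of_set _|.
by apply/setP => w; rewrite !inE /edge /=; case: v w => [] [].
Qed.

Lemma eigenvalue_K2 (R : numFieldType) : eigenvalue (normalized_laplacian K2 R) 2.
Proof.
apply/eigenvalue_normalized_laplacian => [v|]; first by rewrite deg_K2.
(* The alternating function: its value at the only neighbor of [u] is [- f u], so
   [f u - (- f u) = 2 * f u]. *)
exists (fun v : bool => (-1) ^+ v); split; first by exists true; rewrite signr_eq0.
by case; rewrite deg_K2 big_bool /edge /=; ring.
Qed.

Unset Implicit Arguments.
Set Strict Implicit.

Theorem theorem6p2 (R : rcfType) :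
  (forall (G : sgraph) (c : {ffun G -> 'I_(chromatic_number G)}) (x lambda : R),
     (2 <= #|G|)%N ->
     connected G ->
     proper_coloring c ->
     decreasing_classes c ->
     is_min_degree_ratio c x ->
     is_largest_eigenvalue (normalized_laplacian G R) lambda ->
     lambda <= 1 / x * (#|G|%:R / (#|G|%:R - #|color_class c 0|%:R)))
  /\
  (exists (G : sgraph) (c : {ffun G -> 'I_(chromatic_number G)}) (x lambda : R),
     (2 <= #|G|)%N /\
     connected G /\
     proper_coloring c /\
     decreasing_classes c /\
     is_min_degree_ratio c x /\
     is_largest_eigenvalue (normalized_laplacian G R) lambda /\
     lambda = 1 / x * (#|G|%:R / (#|G|%:R - #|color_class c 0|%:R))).
Proof.
split=> [G c x a G2 Gconn cP c_decr xP [aP _]|].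
  exact: normalized_laplacian_eigenvalue_le xP aP.
exists K2; have K2E : #|K2| = 2 by rewrite card_bool.
have K2conn : connected K2.
  by move=> u v; have [->|uv] := eqVneq u v; [exact: connect0 | exact: connect1].
(* The type of the coloring depends on the chromatic number, so it becomes ['I_2] before the witness
   is given. *)
rewrite chromatic_number_K2.
pose c := K2_coloring.
have classE (b : bool) : color_class c b = [set b].
  apply/setP => v; rewrite !inE val_K2_coloring.
  by case: v b => [] [].
have cP : proper_coloring c := proper_K2_coloring.
have c_decr : decreasing_classes c.
  move=> i j /andP[ij j2].
  have cardE m : (m < 2)%N -> #|color_class c m| = 1%N.
    by case: m => [|[|//]] _; [rewrite (classE false) | rewrite (classE true)]; rewrite cards1.
  by rewrite !cardE // (leq_ltn_trans ij).
have xP : is_min_degree_ratio c (1 : R).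
  (* Every degree is 1 and both classes are singletons, so each ratio is [1 / (2 - 1)]. *)
  have ratioE (i : 'I_2) (v : K2) :
      (deg v)%:R / (#|K2|%:R - #|color_class c i|%:R) = 1 :> R.
    have -> : color_class c i = [set (i == 1 :> nat)].
      by rewrite -classE; case: i => [[|[|//]]].
    by rewrite deg_K2 K2E cards1 -natrB // divr1.
  split; last by move=> _ [i [v [_ ->]]]; rewrite ratioE.
  by exists (c true), true; rewrite inE ratioE.
have boundE : 1 / 1 * (#|K2|%:R / (#|K2|%:R - #|color_class c 0|%:R)) = 2 :> R.
  by rewrite (classE false) cards1 K2E -natrB // !divr1 mul1r.
exists c, 1, 2; rewrite boundE; do !split=> //; first by rewrite K2E.
  exact: eigenvalue_K2.
(* Since 2 is the value of the general bound here, that bound gives maximality. *)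
move=> a aP; rewrite -boundE.
by apply: normalized_laplacian_eigenvalue_le xP aP; rewrite ?K2E.
Qed.
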